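(* Let $G=K\rtimes H$ be an FPF group of Type VI, with $K=\langle A,B\rangle$, $H=\langle \operatorname{SL}_2(\mathbb{F}_5),S\rangle$, $\sigma\in\operatorname{Aut}(K)$ and parameters $m,n,r,s,t$ as described in the context. Let $a_d(X)$ denote the number of elements of order $d$ in $X$. Let $d\mid 240|K|$ be written as $d=d_1d_2$ with $d_1\mid |K|$ and $d_2\mid 120$ (such a decomposition is unique when it exists). Then \[a_{d_1d_2}(G)=a_{d_1}(K)\,a_{d_2}\bigl(\operatorname{SL}_2(\mathbb{F}_5)\bigr)+b_{d_1}(\sigma)\,a_{d_2}\bigl(\operatorname{SL}_2(\mathbb{F}_5)\cdot S\bigr),\] and $a_d(G)=0$ for the remaining divisors $d$ of $240|K|$. Here: (i) writing $d_1=ef$ with $e\mid m$, $f\mid n$, \[a_{ef}(K)=\varphi(e)\sum_{\substack{0\le j<n\\ \operatorname{ord}(B^j)=f}}(m,S_{B^j})\left[e\mid \tfrac{m}{(m,S_{B^j})}\right],\qquad S_{B^j}=\sum_{q=0}^{f-1}r^{jq};\] (ii) $b_{d_1}(\sigma)=\#\{k\in K: \operatorname{ord}(k\sigma(k))=d_1\}$, given by \[b_{d_1}(\sigma)=\sum_{j=0}^{n-1}\tau_j\,\varphi\Bigl(\frac{d_1}{e_j}\Bigr)\Bigl[e_j\mid d_1\text{ and }\frac{d_1}{e_j}\mid\frac{m}{\tau_j}\Bigr],\] with $e_j=\frac{n}{(n,j(1+t))}$, $\tau_j=\bigl(m,(1+sr^j)\sum_{q=0}^{e_j-1}r^{j(1+t)q}\bigr)$;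 (iii) $a_{d}(\operatorname{SL}_2(\mathbb{F}_5))=1,1,20,30,24,20,24$ for $d=1,2,3,4,5,6,10$ respectively and $0$ otherwise; (iv) $a_{d}(\operatorname{SL}_2(\mathbb{F}_5)\cdot S)=20,60,40$ for $d=4,8,12$ respectively and $0$ otherwise.
   Context: Setting (Type VI groups). $K=\langle A,B\mid A^m=B^n=1,\ BAB^{-1}=A^r\rangle$ is a group of Type I: $m,n\ge1$, $((r-1)n,m)=1$, $r^n\equiv1\pmod m$, and, if $\delta$ denotes the order of $r$ in $(\mathbb{Z}/m\mathbb{Z})^\times$ (so $\delta\mid n$), $n/\delta$ is divisible by every prime divisor of $\delta$; $|K|=mn$, and it is assumed that $(|K|,30)=1$. $H=\langle \operatorname{SL}_2(\mathbb{F}_5),S\rangle$ is the group of order $240$ containing $\operatorname{SL}_2(\mathbb{F}_5)$ as a normal subgroup of index $2$, with $S\notin\operatorname{SL}_2(\mathbb{F}_5)$, $S^2=-I\in\operatorname{SL}_2(\mathbb{F}_5)$, and $SxS^{-1}=\theta(x)$ for $x\in\operatorname{SL}_2(\mathbb{F}_5)$, where $\theta$ is conjugation by $\begin{pmatrix}0&-1\\2&0\end{pmatrix}$. $G=K\rtimes H$, where $\operatorname{SL}_2(\mathbb{F}_5)$ acts trivially on $K$ and $S$ acts on $K$ through an automorphism $\sigma$ with $\sigma(A)=A^s$, $\sigma(B)=B^t$, where $s^2\equiv1\pmod m$, $t^2\equiv1\pmod n$, $r^{t-1}\equiv1\pmod m$; thus $|G|=240|K|$. $\operatorname{SL}_2(\mathbb{F}_5)\cdot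 S$ is the nontrivial coset of $\operatorname{SL}_2(\mathbb{F}_5)$ in $H$. $(x,y)$ denotes gcd (with $(m,0)=m$), $\varphi$ is Euler's totient function, and $[\cdot]$ is the indicator function (a product with a vanishing indicator is $0$). *)

(* Defs.v *)
From HB Require Import structures.
From mathcomp Require Import all_boot all_order all_fingroup all_algebra.

Set Implicit Arguments.
Unset Strict Implicit.
Unset Printing Implicit Defensive.

Import GroupScope.

Definition num_order (gT : finGroupType) (d : nat) (X : {set gT}) : nat :=
  #|[set x in X | #[x] == d]|.

Definition mult_order_mod (m r delta : nat) : Prop :=
  [/\ (0 < delta)%N, (r ^ delta)%N = 1 %[mod m]
    & forall k : nat, (0 < k)%N -> (r ^ k)%N = 1 %[mod m] -> (delta <= k)%N].

(* The parameters r, s, t are natural representatives of their residue classes.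
   The subtraction in (r - 1) is truncated only if r = 0, which the other
   conditions allow only for m = 1; similarly t = 0 is possible in [typeVI]
   only for m = n = 1. *)
Record typeI (gT : finGroupType) (K : {group gT}) (A B : gT)
    (m n r : nat) : Prop := TypeI {
  typeI_m : (0 < m)%N;
  typeI_n : (0 < n)%N;
  typeI_coprime : coprime ((r - 1) * n) m;
  typeI_exp : (r ^ n)%N = 1 %[mod m];
  typeI_delta : forall delta : nat, mult_order_mod m r delta ->
    forall p : nat, prime p -> (p %| delta)%N -> (p %| n %/ delta)%N;
  typeI_gen : K :=: <<[set A; B]>>;
  typeI_A : A ^+ m = 1;
  typeI_B : B ^+ n = 1;
  typeI_BA : B * A * B^-1 = A ^+ r;
  typeI_Grp : K \isog Grp (a : b : (a ^+ m, b ^+ n, b * a * b^-1 = a ^+ r));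
  typeI_card : #|K| = (m * n)%N
}.

Section SL2F5.
Local Open Scope ring_scope.

Definition SL2F5 : {set {'GL_2['F_5]}} := [set x | \det (GLval x) == 1].

Lemma SL2F5_group_set : group_set SL2F5.
Proof.
apply/group_setP; split=> [|x y]; first by rewrite inE GL_1E det1.
by rewrite !inE GL_ME det_mulmx => /eqP-> /eqP->; rewrite GRing.mulr1.
Qed.

Canonical SL2F5_group := Group SL2F5_group_set.

Lemma negI_unit : (-1 : 'M['F_5]_2) \is a GRing.unit.
Proof. by rewrite GRing.unitrN1. Qed.

Definition negI : {'GL_2['F_5]} := FinRing.Unit negI_unit.

Definition theta_mx : 'M['F_5]_2 :=
  \matrix_(i, j) (if i == 0 then if j == 0 then 0 else -1
                  else if j == 0 then 2%:R else 0).

Lemma theta_mx_unit : theta_mx \is a GRing.unit.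
Proof.
rewrite -[_ \is a _]/(theta_mx \in unitmx) unitmxE.
by rewrite (expand_det_row _ ord0) !big_ord_recl big_ord0 /cofactor !det_mx11 !mxE.
Qed.

Definition theta_GL : {'GL_2['F_5]} := FinRing.Unit theta_mx_unit.

Definition theta (x : {'GL_2['F_5]}) : {'GL_2['F_5]} :=
  (theta_GL * x * theta_GL^-1)%g.

End SL2F5.

(* SL_2(F_5) sits in gT through an injective morphism iota. *)
Record typeVI (gT : finGroupType) (G K H : {group gT}) (A B S : gT)
    (iota : {morphism SL2F5 >-> gT}) (sigma : {perm gT})
    (m n r s t : nat) : Prop := TypeVI {
  typeVI_K : typeI K A B m n r;
  typeVI_coprime : coprime #|K| 30;
  typeVI_inj : 'injm iota;
  typeVI_H : H :=: <<S |: iota @* SL2F5>>;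
  typeVI_card : #|H| = 240;
  typeVI_normal : iota @* SL2F5 <| H;
  typeVI_index : #|H : iota @* SL2F5| = 2;
  typeVI_S : S \notin iota @* SL2F5;
  typeVI_S2 : S ^+ 2 = iota negI;
  typeVI_theta : forall x : {'GL_2['F_5]}, x \in SL2F5 ->
    S * iota x * S^-1 = iota (theta x);
  typeVI_sdprod : K ><| H = G;
  typeVI_triv : iota @* SL2F5 \subset 'C(K);
  typeVI_Aut : sigma \in Aut K;
  typeVI_act : forall k : gT, k \in K -> S * k * S^-1 = sigma k;
  typeVI_sA : sigma A = A ^+ s;
  typeVI_sB : sigma B = B ^+ t;
  typeVI_s2 : (s ^ 2)%N = 1 %[mod m];
  typeVI_t2 : (t ^ 2)%N = 1 %[mod n];
  typeVI_rt : (r ^ (t - 1))%N = 1 %[mod m]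
}.

Definition bnum (gT : finGroupType) (K : {group gT}) (sigma : {perm gT})
    (d : nat) : nat :=
  #|[set k in K | #[k * sigma k] == d]|.

Definition geomB (r j f : nat) : nat := (\sum_(q < f) r ^ (j * q))%N.

Definition e_ (n t j : nat) : nat := (n %/ gcdn n (j * (1 + t)))%N.

Definition tau_ (m n r s t j : nat) : nat :=
  gcdn m ((1 + s * r ^ j) * \sum_(q < e_ n t j) r ^ (j * (1 + t) * q))%N.

Definition num_order_SL2F5 (d : nat) : nat :=
  match d with
  | 1 => 1 | 2 => 1 | 3 => 20 | 4 => 30 | 5 => 24 | 6 => 20 | 10 => 24 | _ => 0
  end.

Definition num_order_SL2F5S (d : nat) : nat :=
  match d with 4 => 20 | 8 => 60 | 12 => 40 | _ => 0 end.

(* Main.v *)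
(* The normal form A^i B^j of K satisfies (A^i B^j)^f = A^(i S) with f = ord(B^j)
   and S = S_(B^j); since <A> and <B> meet trivially, its order is
   f * ord(A^(i S)), and counting reduces to the cyclic group <A>.  With
   L = SL_2(F_5), every element of G is k h with k in K and h in L or in L S.  If
   h is in L, then k and h commute and have coprime orders; if h is in L S, then
   (k h)^2 = (k sigma(k)) h^2 with h^2 in L, whence
   ord(k h) = ord(k sigma(k)) * ord(h).  The orders in L and in L S, where
   (x S)^2 = - x theta(x), are found by enumerating the 120 elements of L. *)

Require Import Defs.
From HB Require Import structures.
From mathcomp Require Import all_boot all_order all_fingroup all_algebra.
From mathcomp Require Import cyclic.

Set Implicit Arguments.
Unset Strict Implicit.
Unset Printing Implicit Defensive.

(** * Counting elements by order: product sets, cyclic groups, coprime factors *)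

Section Counting.
Local Open Scope group_scope.

Lemma card_sum_order (gT : finGroupType) (d : nat) (X : {set gT})
    (f : gT -> gT) :
  #|[set x in X | #[f x] == d]| = (\sum_(x in X) (#[f x]%g == d))%N.
Proof.
rewrite -sum1_card big_mkcond [RHS]big_mkcond /=.
by apply: eq_bigr => x _; rewrite inE; case: (x \in X); case: eqP.
Qed.

Lemma num_orderE (gT : finGroupType) (d : nat) (X : {set gT}) :
  num_order d X = (\sum_(x in X) (#[x]%g == d))%N.
Proof. exact: card_sum_order id. Qed.

(** Trivial intersection makes [(k, h) -> k * h] injective on pairs, since [k * h = k' * h'] puts
    [k'^-1 * k = h' * h^-1] in both groups. The sum over the product set is thus a reindexed sum
    over pairs. *)
Lemma sum_TI_mulg (gT : finGroupType) (N H : {group gT}) (F : gT -> nat) :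
  N :&: H = 1 ->
  (\sum_(x in (N * H)%g) F x = \sum_(h in H) \sum_(k in N) F (k * h)%g)%N.
Proof.
move=> tiNH; rewrite exchange_big pair_big /=.
rewrite (eq_bigl (mem [set (k, h) | k in N, h in H])); last first.
  case=> k h; apply/andP/imset2P => [[Nk Hh] | [k' h' Nk' Hh' [-> ->]]] //.
  by exists k h.
rewrite -(@big_imset _ _ _ _ _ (fun u => u.1 * u.2) _ F) /=; last first.
  move=> _ _ /imset2P[k h Nk Hh ->] /imset2P[k' h' Nk' Hh' ->] /= eq_kh.
  have: k'^-1 * k \in N :&: H.
    rewrite inE groupM ?groupV //=.
    rewrite (_ : k'^-1 * k = h' * h^-1) ?groupM ?groupV //.
    by rewrite -[k](mulgK h) eq_kh !mulgA mulVg mul1g.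
  rewrite tiNH => /set1P eq_k.
  have {}eq_k : k = k' by apply/(mulgI k'^-1); rewrite eq_k mulVg.
  by move: eq_kh; rewrite eq_k => /mulgI ->.
apply: eq_bigl => x; apply/mulsgP/imsetP => [[k h Nk Hh ->] | [u]].
  by exists (k, h) => //; apply/imset2P; exists k h.
by case/imset2P=> k h Nk Hh -> ->; exists k h.
Qed.

(** If [y] had odd order, [y ^+ 2] would generate [<[y]>] and [y] would lie in [N]. So the order is
    even, and squaring halves it. *)
Lemma order_sq_index2 (gT : finGroupType) (N : {group gT}) (y : gT) :
  y \notin N -> y ^+ 2 \in N -> #[y] = (2 * #[y ^+ 2])%N.
Proof.
move=> notNy Ny2; have dv2 : (2 %| #[y])%N.
  rewrite dvdn2; apply: contra notNy => odd_y.
  have: generator <[y]> (y ^+ 2) by rewrite generator_coprime coprimen2.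
  by rewrite /generator -cycle_subG => /eqP ->; rewrite cycle_subG.
by rewrite orderXdiv // mulnC divnK.
Qed.

Lemma sum_rcoset (gT : finGroupType) (A : {set gT}) (y : gT) (F : gT -> nat) :
  (\sum_(x in A :* y) F x = \sum_(x in A) F (x * y)%g)%N.
Proof.
by rewrite -rcosetE big_imset //= => ? ? _ _ /mulIg.
Qed.

Lemma sum_cycle (gT : finGroupType) (a : gT) (m : nat) (F : gT -> nat) :
  #[a] = m -> (\sum_(x in <[a]>) F x = \sum_(i < m) F (a ^+ i)%g)%N.
Proof.
move=> <- {m}.
have inj_a : injective (fun i : 'I_#[a] => a ^+ i).
  by move=> i j /eqP; rewrite eq_expg_mod_order !modn_small // => /eqP/val_inj.
rewrite -(@big_imset _ _ _ _ _ (fun i : 'I_#[a] => a ^+ i) predT F) /=; last first.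
  by move=> i j _ _; exact: inj_a.
apply: eq_bigl => x; apply/idP/imsetP => [/cyclePmin[i lt_i ->] | [i _ ->]].
  by exists (Ordinal lt_i).
exact: mem_cycle.
Qed.

(** For [e] dividing [#[a]], the elements of order [e] are the generators of the unique subgroup of
    that order, generated by [a ^+ (#[a] %/ e)]. *)
Lemma num_order_cycle (gT : finGroupType) (a : gT) (e : nat) :
  num_order e <[a]> = (totient e * (e %| #[a]))%N.
Proof.
have [dv_e | ndv_e] := boolP (e %| #[a])%N; last first.
  rewrite muln0; apply: eq_card0 => x; rewrite !inE; apply/negP => /andP[ax].
  by move/eqP=> ord_x; rewrite -ord_x order_dvdG in ndv_e.
have e_gt0 := dvdn_gt0 (order_gt0 a) dv_e.
have ord_b : #[a ^+ (#[a] %/ e)] = e.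
  by rewrite orderXdiv ?divnA ?mulKn // -{2}(divnK dv_e) dvdn_mulr.
rewrite muln1 -{2}ord_b totient_gen; apply: eq_card => x; rewrite !inE.
apply/andP/idP => [[ax /eqP ord_x] | /eqP eq_bx].
  rewrite /generator (eq_subG_cyclic (cycle_cyclic a)) ?cycle_subG ?mem_cycle //.
  by rewrite -!orderE ord_b ord_x.
rewrite orderE -eq_bx -orderE ord_b eqxx -cycle_subG -eq_bx cycle_subG.
by rewrite mem_cycle.
Qed.

Lemma sum_periodic (F : nat -> nat) (g M : nat) :
  (forall i, F (i + M) = F i) ->
  (\sum_(i < g * M) F i = g * \sum_(i < M) F i)%N.
Proof.
move=> perF; elim: g => [|g IHg]; first by rewrite !mul0n big_ord0.
rewrite !mulSn -IHg [in LHS]addnC big_split_ord /= addnC; congr (_ + _)%N.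
apply: eq_bigr => i _; rewrite addnC.
by elim: g {IHg} => [|g IHg]; rewrite ?mul0n ?addn0 // mulSn addnCA addnC perF.
Qed.

(** As [i] runs through a range of length [m], the power [a ^+ (i * X)] runs [gcdn m X] times
    through the cyclic group [<[a ^+ X]>] of order [m %/ gcdn m X]. *)
Lemma count_orderX (gT : finGroupType) (a : gT) (m X e : nat) :
  #[a] = m ->
  (\sum_(i < m) (#[a ^+ (i * X)] == e) =
   gcdn m X * totient e * (e %| m %/ gcdn m X))%N.
Proof.
move=> ord_a; set g := gcdn m X.
have ord_c : #[a ^+ X] = (m %/ g)%N by rewrite orderXgcd ord_a.
have m_g : m = (g * #[a ^+ X])%N by rewrite ord_c mulnC divnK ?dvdn_gcdl.
(* Passing from ordinals to a range lets the upper bound alone be rewritten as [g] periods. *)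
rewrite -(big_mkord xpredT (fun i => #[a ^+ (i * X)] == e : nat)).
rewrite [X in index_iota _ X]m_g big_mkord.
rewrite (sum_periodic (F := fun i => #[a ^+ (i * X)] == e :> nat)); last first.
  move=> i; rewrite mulnDl [(#[_] * X)%N]mulnC expgD expgM [X in _ * X]expgM.
  by rewrite expg_order mulg1.
rewrite -mulnA -ord_c -num_order_cycle num_orderE (sum_cycle _ (erefl _)).
by congr (_ * _)%N; apply: eq_bigr => i _; rewrite mulnC expgM.
Qed.

Lemma gcdn_mul_coprime (m n a b : nat) :
  coprime m n -> (a %| m -> b %| n -> gcdn m (a * b) = a)%N.
Proof.
move=> co_mn dv_a dv_b; rewrite Gauss_gcdl ?(coprime_dvdr dv_b) //.
exact/gcdn_idPr.
Qed.

(** Each factor is recovered from the product as its gcd with [m] or with [n]. This lets a condition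
    on a product of orders split into two independent ones. *)
Lemma eqn_mul_coprime (m n a b a' b' : nat) : coprime m n ->
  (a %| m -> b %| n -> a' %| m -> b' %| n ->
   (a * b == a' * b') = (a == a') && (b == b'))%N.
Proof.
move=> co_mn dv_a dv_b dv_a' dv_b'.
apply/eqP/andP => [eq_ab | [/eqP-> /eqP->] //]; split; apply/eqP.
  by rewrite -(gcdn_mul_coprime co_mn dv_a dv_b) eq_ab (gcdn_mul_coprime co_mn).
rewrite coprime_sym in co_mn.
rewrite -(gcdn_mul_coprime co_mn dv_b dv_a) [(b * a)%N]mulnC eq_ab.
by rewrite [(a' * _)%N]mulnC (gcdn_mul_coprime co_mn).
Qed.

End Counting.

(** * Computable 2 x 2 matrices over F_5 and their orders *)

Section SL2F5Orders.

(* ((a, b), (c, d)) is the 2 x 2 matrix over 'F_5 with rows (a, b) and (c, d), each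
   entry given by its residue in {0, ..., 4}: unlike 'M['F_5]_2, it computes. *)
Definition quad : Type := ((nat * nat) * (nat * nat))%type.

Definition quad_mul (x y : quad) : quad :=
  let: ((a, b), (c, d)) := x in let: ((a', b'), (c', d')) := y in
  (((a * a' + b * c') %% 5, (a * b' + b * d') %% 5),
   ((c * a' + d * c') %% 5, (c * b' + d * d') %% 5)).

Definition quad_exp (x : quad) (k : nat) : quad :=
  iter k (quad_mul x) ((1, 0), (0, 1)).

(* Equal to 11 by default if no power up to 10 is the identity, which does not
   happen for matrices of determinant 1. *)
Definition quad_order (x : quad) : nat :=
  (find (fun k => quad_exp x k.+1 == ((1, 0), (0, 1))) (iota 0 10)).+1.

(* theta_mx has order 8, so T^7 is its inverse. *)
Definition quad_theta (x : quad) : quad :=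
  let T := ((0, 4), (2, 0)) in quad_mul (quad_mul T x) (quad_exp T 7).

(* 4 stands for -1. *)
Definition quad_det (x : quad) : nat :=
  let: ((a, b), (c, d)) := x in (a * d + 4 * (b * c)) %% 5.

Definition SL2_quads : seq quad :=
  let rows := [seq (a, b) | a <- iota 0 5, b <- iota 0 5] in
  [seq x <- [seq (u, v) | u <- rows, v <- rows] | quad_det x == 1].

(* Applied to x in SL_2(F_5), the matrix of (x S)^2 = x theta(x) S^2. *)
Definition quad_square (x : quad) : quad :=
  quad_mul (quad_mul x (quad_theta x)) ((4, 0), (0, 4)).

Lemma mem_SL2_quads (a b c d : nat) :
  (((a, b), (c, d)) \in SL2_quads) =
  [&& a < 5, b < 5, c < 5, d < 5 & quad_det ((a, b), (c, d)) == 1].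
Proof.
have mem_pairs (u v : nat) :
    ((u, v) \in [seq (i, j) | i <- iota 0 5, j <- iota 0 5]) = (u < 5) && (v < 5).
  apply/allpairsP/andP => [[[i j] [i_lt j_lt [-> ->]]] | [u_lt v_lt]].
    by rewrite !mem_iota in i_lt j_lt.
  by exists (u, v); rewrite !mem_iota.
rewrite mem_filter andbC !andbA -!andbA.
rewrite (_ : _ \in _ = [&& a < 5, b < 5, c < 5 & d < 5]) -?andbA //.
apply/allpairsP/and4P => [[[[i j] [k l]]] | [a_lt b_lt c_lt d_lt]].
  rewrite !mem_pairs => -[/andP[i_lt j_lt] /andP[k_lt l_lt] [-> -> -> ->]].
  by split.
by exists ((a, b), (c, d)); rewrite !mem_pairs; split=> //; apply/andP.
Qed.

Lemma quad_exp_order x :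
  x \in SL2_quads -> quad_exp x (quad_order x) = ((1, 0), (0, 1)).
Proof.
have: all (fun x => quad_exp x (quad_order x) == ((1, 0), (0, 1))) SL2_quads.
  by vm_compute.
by move=> /allP all_x /all_x /eqP.
Qed.

Lemma quad_exp_lt_order x k : 0 < k < quad_order x ->
  quad_exp x k != ((1, 0), (0, 1)).
Proof.
case: k => // k /andP[_]; rewrite ltnS => lt_k.
have := before_find 0 lt_k; rewrite nth_iota ?add0n => [->//|].
(* Reading entry [k] of the list requires [k < 10]; this holds as [find] never exceeds the length of
   the list. *)
by rewrite -[10](size_iota 0); exact: leq_trans lt_k (find_size _ _).
Qed.

Local Open Scope group_scope.

(** * Transfer from SL_2(F_5) to the computable model *)

Definition quad_mx (M : 'M['F_5]_2) : quad :=
  let i0 : 'I_2 := ord0 in let i1 : 'I_2 := ord_max in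
  ((M i0 i0 : nat, M i0 i1 : nat), (M i1 i0 : nat, M i1 i1 : nat)).

Definition quad_of (x : {'GL_2['F_5]}) : quad := quad_mx (GLval x).

Lemma quad_of_inj : injective quad_of.
Proof.
move=> x y [/val_inj e00 /val_inj e01 /val_inj e10 /val_inj e11].
apply/val_inj/matrixP=> i j.
have ordE (k : 'I_2) : k = ord0 \/ k = ord_max.
  by case: k => [[|[|//]] lt_k]; [left | right]; apply/val_inj.
by case: (ordE i) => ->; case: (ordE j) => ->.
Qed.

Lemma quad_of1 : quad_of 1 = ((1, 0), (0, 1))%N.
Proof. by rewrite /quad_of /quad_mx GL_1E !mxE. Qed.

Lemma quad_ofM x y : quad_of (x * y) = quad_mul (quad_of x) (quad_of y).
Proof.
rewrite /quad_of /quad_mx GL_ME /quad_mul !mxE !big_ord_recl !big_ord0 !GRing.addr0.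
have -> : lift ord0 ord0 = ord_max :> 'I_2 by apply/val_inj.
by rewrite /= !modnDm.
Qed.

Lemma quad_of_negI : quad_of negI = ((4, 0), (0, 4))%N.
Proof. by rewrite /quad_of /quad_mx !mxE. Qed.

Lemma quad_mx_det M : (\det M = (quad_det (quad_mx M))%:R)%R.
Proof.
rewrite (expand_det_row _ ord0) !big_ord_recl big_ord0 GRing.addr0 /cofactor.
rewrite !det_mx11 !mxE /quad_mx /quad_det.
have -> : lift ord0 ord0 = ord_max :> 'I_2 by apply/val_inj.
have -> : lift ord_max ord0 = ord0 :> 'I_2 by apply/val_inj.
rewrite Fp_nat_mod // GRing.natrD !GRing.natrM !natr_Zp.
rewrite (_ : 4%:R = -1)%R; last exact/val_inj.
by rewrite ?GRing.mulN1r ?GRing.mul1r -?GRing.mulrN.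
Qed.

Lemma det_eq1 M : (\det M == 1)%R = (quad_det (quad_mx M) == 1)%N.
Proof.
rewrite quad_mx_det.
have: (quad_det (quad_mx M) < 5)%N by rewrite ltn_mod.
by move: (quad_det _); do 5!case=> //.
Qed.

Lemma quad_ofX x k : quad_of (x ^+ k) = quad_exp (quad_of x) k.
Proof.
by elim: k => [|k IHk]; rewrite ?expg0 ?quad_of1 // expgS quad_ofM IHk.
Qed.

Lemma quad_of_theta x : quad_of (theta x) = quad_theta (quad_of x).
Proof.
have TE : quad_of theta_GL = ((0, 4), (2, 0))%N by rewrite /quad_of /quad_mx !mxE.
have -> : theta x = theta_GL * x * theta_GL ^+ 7.
  (* That [theta_GL] has eighth power 1 is checked by computing in the model. *)
  rewrite /theta; congr (_ * _); apply/(mulgI theta_GL); rewrite mulgV -expgS.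
  by apply/quad_of_inj; rewrite quad_of1 quad_ofX TE.
by rewrite quad_ofM quad_ofX quad_ofM TE.
Qed.

(** This turns any sum over the group into a sum over an explicit list, which can be evaluated. *)
Lemma quad_of_perm : perm_eq [seq quad_of x | x in SL2F5] SL2_quads.
Proof.
apply: uniq_perm.
- by rewrite map_inj_uniq ?enum_uniq //; exact: quad_of_inj.
- by vm_compute.
move=> q; apply/mapP/idP => [[x] | ].
  rewrite mem_enum inE det_eq1 => det1 -> {q}.
  by rewrite mem_SL2_quads !ltn_ord.
case: q => [[a b] [c d]]; rewrite mem_SL2_quads.
case/and5P=> a_lt b_lt c_lt d_lt det_q.
pose M : 'M['F_5]_2 := (\matrix_(i, j)
  (if i == 0 then if j == 0 then a else b else if j == 0 then c else d)%:R)%R.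
have qM : quad_mx M = ((a, b), (c, d)).
  by rewrite /quad_mx !mxE /= !val_Fp_nat // !modn_small.
have det1 : (\det M == 1)%R by rewrite det_eq1 qM.
have unitM : M \is a GRing.unit.
  by rewrite -[_ \is a _]/(M \in unitmx) unitmxE (eqP det1) GRing.unitr1.
by exists (FinRing.Unit unitM); rewrite ?mem_enum ?inE //= /quad_of /= qM.
Qed.

(** The power at [quad_order] is the identity, which bounds the order from above; no smaller
    positive power is, which bounds it from below. *)
Lemma quad_of_order x : x \in SL2F5 -> #[x] = quad_order (quad_of x).
Proof.
move=> Lx; have q_x : quad_of x \in SL2_quads.
  by rewrite -(perm_mem quad_of_perm) map_f ?mem_enum.
have x_ord : x ^+ quad_order (quad_of x) = 1.
  by apply/quad_of_inj; rewrite quad_ofX quad_exp_order ?quad_of1.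
apply/eqP; rewrite eqn_leq dvdn_leq ?order_dvdn ?x_ord //= leqNgt.
apply/negP => lt_x; have := @quad_exp_lt_order (quad_of x) #[x].
by rewrite order_gt0 lt_x -quad_ofX expg_order quad_of1 eqxx => /(_ isT).
Qed.

Lemma sum_SL2F5 (F : quad -> nat) :
  (\sum_(x in SL2F5) F (quad_of x) = \sum_(q <- SL2_quads) F q)%N.
Proof.
by rewrite -(perm_big _ quad_of_perm) big_map big_enum.
Qed.

Lemma num_order_SL2F5E d : num_order d SL2F5 = num_order_SL2F5 d.
Proof.
rewrite num_orderE.
rewrite (eq_bigr (fun x => (quad_order (quad_of x) == d) : nat)); last first.
  by move=> x /quad_of_order->.
rewrite (sum_SL2F5 (fun q => quad_order q == d : nat)).
rewrite -(big_map quad_order xpredT (fun k => k == d : nat)).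
rewrite -[LHS]big_mkcond sum1_count.
(* The values 0 to 10 of [d] are computed one by one; beyond them both sides reduce to 0, as no
   listed matrix has order above 10. *)
by do 11!(case: d => [|d]; first by vm_compute).
Qed.

(** The left side counts the [x] for which [x S] has order [d]: that order is twice the order of
    [(x S)^2], whose matrix is [quad_square]. *)
Lemma sum_SL2F5_square d :
  (\sum_(x in SL2F5) (2 * quad_order (quad_square (quad_of x)) == d) =
   num_order_SL2F5S d)%N.
Proof.
rewrite (sum_SL2F5 (fun q => 2 * quad_order (quad_square q) == d : nat)%N).
rewrite -(big_map (fun q => 2 * quad_order (quad_square q))%N xpredT
  (fun k => k == d : nat)) -[LHS]big_mkcond sum1_count.
by do 13!(case: d => [|d]; first by vm_compute).
Qed.

Lemma negI_SL2F5 : negI \in SL2F5.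
Proof. by rewrite inE det_eq1 /quad_mx !mxE. Qed.

(** Multiplying by [theta_GL] on the right leaves [theta_GL * x], and the nonzero determinant of
    [theta_GL] cancels. *)
Lemma theta_SL2F5 x : x \in SL2F5 -> theta x \in SL2F5.
Proof.
rewrite !inE => /eqP det_x; apply/eqP/(GRing.mulIf (GL_det theta_GL)).
by rewrite -det_mulmx -[(_ *m _)%R]GL_ME mulgKV GL_ME det_mulmx det_x GRing.mulrC.
Qed.

Lemma quad_of_square x :
  quad_of (x * theta x * negI) = quad_square (quad_of x).
Proof.
by rewrite quad_ofM [quad_of (x * _)]quad_ofM quad_of_theta quad_of_negI.
Qed.

End SL2F5Orders.

(** * Orders in the metacyclic group K, and of [k * sigma k] *)

Section TypeI.
Local Open Scope group_scope.

Variables (gT : finGroupType) (K : {group gT}) (A B : gT) (m n r : nat).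
Hypothesis hK : typeI K A B m n r.

Lemma typeI_mulg : <[A]> * <[B]> = K.
Proof.
have nAB : <[B]> \subset 'N(<[A]>).
  rewrite cycle_subG -groupV inE -cycleJ cycle_subG /conjg invgK mulgA.
  by rewrite (typeI_BA hK) mem_cycle.
by rewrite -norm_joinEr // (typeI_gen hK) /cycle joing_idl joing_idr.
Qed.

(** The relations make the orders divide [m] and [n], and [m * n = #|K|] is at most the product of
    the orders, which forces equality. *)
Lemma typeI_orders : #[A] = m /\ #[B] = n.
Proof.
have dvA : #[A] %| m by rewrite order_dvdn (typeI_A hK).
have dvB : #[B] %| n by rewrite order_dvdn (typeI_B hK).
have leA := dvdn_leq (typeI_m hK) dvA; have leB := dvdn_leq (typeI_n hK) dvB.
have := mul_cardG <[A]> <[B]>; rewrite typeI_mulg (typeI_card hK) -!orderE.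
move=> cardAB; have le_mn : m * n <= #[A] * #[B].
  by rewrite cardAB leq_pmulr ?cardG_gt0.
have m_gt0 := typeI_m hK; have n_gt0 := typeI_n hK.
split; apply/eqP; rewrite eqn_leq ?leA ?leB /=.
  by rewrite -(leq_pmul2r n_gt0) (leq_trans le_mn) // leq_mul2l leB orbT.
by rewrite -(leq_pmul2l m_gt0) (leq_trans le_mn) // leq_mul2r leA orbT.
Qed.

Let ordA : #[A] = m. Proof. by case: typeI_orders. Qed.
Let ordB : #[B] = n. Proof. by case: typeI_orders. Qed.

Lemma typeI_TI : <[A]> :&: <[B]> = 1.
Proof.
apply: card_le1_trivg; have := mul_cardG <[A]> <[B]>.
rewrite typeI_mulg (typeI_card hK) -!orderE ordA ordB.
rewrite -{1}[(m * n)%N]muln1 => /eqP.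
rewrite eqn_pmul2l ?muln_gt0 ?(typeI_m hK) ?(typeI_n hK) //.
by move=> /eqP <-.
Qed.

Lemma typeI_coprime_mn : coprime m n.
Proof.
by have := typeI_coprime hK; rewrite coprimeMl [coprime n m]coprime_sym => /andP[].
Qed.

Lemma sum_typeI (F : gT -> nat) :
  (\sum_(k in K) F k = \sum_(j < n) \sum_(i < m) F (A ^+ i * B ^+ j)%g)%N.
Proof.
rewrite -typeI_mulg sum_TI_mulg ?typeI_TI // (sum_cycle _ ordB).
by apply: eq_bigr => j _; rewrite (sum_cycle _ ordA).
Qed.

Lemma typeI_commute (l i : nat) : B ^+ l * A ^+ i = A ^+ (i * r ^ l) * B ^+ l.
Proof.
have BAi k : B * A ^+ k = A ^+ (k * r) * B.
  rewrite [(k * r)%N]mulnC expgM -(typeI_BA hK).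
  have -> : B * A * B^-1 = A ^ B^-1 by rewrite /conjg invgK mulgA.
  by rewrite -conjXg /conjg invgK !mulgA mulgKV.
elim: l i => [|l IHl] i; first by rewrite !expg0 mul1g mulg1 muln1.
by rewrite expgS -mulgA IHl mulgA BAi expnSr mulnA mulgA.
Qed.

(** The factor [A ^+ i] of the next copy must pass [B ^+ (j * k)], which multiplies its exponent by
    [r ^ (j * k)]; these multipliers add up to the geometric sum. *)
Lemma typeI_expg (i j k : nat) :
  (A ^+ i * B ^+ j) ^+ k = A ^+ (i * geomB r j k) * B ^+ (j * k).
Proof.
elim: k => [|k IHk].
  by rewrite /geomB big_ord0 !muln0 !expg0 mulg1.
rewrite expgSr IHk -mulgA [_ * (_ * B ^+ j)]mulgA typeI_commute.
rewrite !mulgA -expgD -mulgA -expgD /geomB big_ord_recr /= mulnDr.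
by rewrite mulnSr.
Qed.

Lemma order_typeI (i j : nat) :
  #[A ^+ i * B ^+ j] =
  (#[B ^+ j] * #[A ^+ (i * geomB r j #[B ^+ j])])%N.
Proof.
set x := A ^+ i * B ^+ j; set f := #[B ^+ j].
have xf : x ^+ f = A ^+ (i * geomB r j f).
  by rewrite typeI_expg [B ^+ _]expgM (expg_order (B ^+ j)) mulg1.
(* From [x ^+ #[x] = 1], the power [B ^+ (j * #[x])] is the inverse of a power of [A], hence
   trivial. *)
have dv_f : f %| #[x].
  rewrite order_dvdn -expgM; have /eqP := expg_order x; rewrite typeI_expg.
  rewrite -eq_invg_mul => /eqP AB_inv.
  have: B ^+ (j * #[x]) \in <[A]> :&: <[B]>.
    by rewrite inE mem_cycle -AB_inv groupV mem_cycle.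
  by rewrite typeI_TI => /set1P ->.
by rewrite -xf orderXdiv // mulnC divnK.
Qed.

(** The order of [A ^+ i * B ^+ j] is a divisor of [m] times a divisor of [n], so it equals [e * f]
    only factor by factor: [j] must give [f], and [count_orderX] then counts the [i]. *)
Lemma num_order_typeI (e f : nat) : (e %| m -> f %| n ->
  num_order (e * f) K =
    totient e * \sum_(j < n | #[(B ^+ j)%g] == f)
      gcdn m (geomB r j f) * (e %| m %/ gcdn m (geomB r j f)))%N.
Proof.
move=> dv_e dv_f; rewrite num_orderE sum_typeI big_distrr [RHS]big_mkcond /=.
apply: eq_bigr => j _.
have dvA x : (#[A ^+ x] %| m)%N by rewrite -ordA orderXgcd dvdn_div ?dvdn_gcdl.
have dvB x : (#[B ^+ x] %| n)%N by rewrite -ordB orderXgcd dvdn_div ?dvdn_gcdl.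
under eq_bigr => i _ do rewrite order_typeI [(#[B ^+ j] * _)%N]mulnC
  (eqn_mul_coprime typeI_coprime_mn (dvA _) (dvB j) dv_e dv_f).
case: eqP => [-> | _]; last by rewrite big1 // => i _; rewrite andbF.
under eq_bigr => i _ do rewrite andbT.
by rewrite (count_orderX _ _ ordA) mulnA [(totient e * _)%N]mulnC.
Qed.

(** For [k = A ^+ i * B ^+ j] the product [k * sigma k] is again in normal form, with exponents
    [i * (1 + s * r ^ j)] and [j * (1 + t)]. Then [e_] is the order of its [B]-part, and
    [count_orderX] applies to the [A]-part. *)
Lemma bnum_typeI (sigma : {perm gT}) (s t d : nat) :
  {in K &, {morph sigma : x y / x * y}} ->
  sigma A = A ^+ s -> sigma B = B ^+ t ->
  bnum K sigma d =
    (\sum_(j < n) tau_ m n r s t j * totient (d %/ e_ n t j) *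
       ((e_ n t j %| d) && (d %/ e_ n t j %| m %/ tau_ m n r s t j)))%N.
Proof.
move=> sM sA sB.
rewrite /bnum (card_sum_order _ _ (fun k => k * sigma k)).
rewrite sum_typeI; apply: eq_bigr => j _.
have KA : A \in K by rewrite (typeI_gen hK) mem_gen // set21.
have KB : B \in K by rewrite (typeI_gen hK) mem_gen // set22.
have sX x k : x \in K -> sigma (x ^+ k) = sigma x ^+ k.
  move=> Kx; elim: k => [|k IHk]; last by rewrite !expgS sM ?groupX // IHk.
  (* The base case is [sigma 1 = 1], by cancelling in [sigma 1 * sigma 1 = sigma 1]. *)
  by apply/(mulgI (sigma 1)); rewrite -sM ?group1 // !mulg1.
have ord_j : #[B ^+ (j * (1 + t))] = e_ n t j by rewrite orderXgcd ordB.
have k_sk (i : nat) : A ^+ i * B ^+ j * sigma (A ^+ i * B ^+ j)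
    = A ^+ (i * (1 + s * r ^ j)) * B ^+ (j * (1 + t)).
  rewrite sM ?groupX // !sX // sA sB -!expgM -mulgA [_ * (_ * B ^+ (t * j))]mulgA.
  rewrite typeI_commute !mulgA -expgD -mulgA -expgD !mulnDr !muln1.
  by rewrite mulnA [(s * i)%N]mulnC [(t * j)%N]mulnC.
under eq_bigr => i _ do rewrite k_sk order_typeI ord_j -mulnA.
have e_gt0 : (0 < e_ n t j)%N by rewrite -ord_j order_gt0.
have [dv_e | ndv_e] := boolP (e_ n t j %| d)%N; last first.
  rewrite muln0 big1 // => i _; case: eqP => // def_d.
  by rewrite -def_d dvdn_mulr in ndv_e.
under eq_bigr => i _ do rewrite -{1}(divnK dv_e) [(_ %/ _ * _)%N]mulnC
  eqn_pmul2l //.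
exact: count_orderX.
Qed.

End TypeI.

(** * The subgroup L of H and its coset L S *)

Section TypeVI.
Local Open Scope group_scope.

Variables (gT : finGroupType) (G K H : {group gT}) (A B S : gT).
Variables (iota : {morphism SL2F5 >-> gT}) (sigma : {perm gT}).
Variables (m n r s t : nat).
Hypothesis hG : typeVI G K H A B S iota sigma m n r s t.

Let L := (iota @* SL2F5)%G.

Lemma typeVI_cardL : #|L| = 120.
Proof.
have := Lagrange (normal_sub (typeVI_normal hG)).
rewrite (typeVI_index hG) (typeVI_card hG) => /eqP.
by rewrite -[240]/(120 * 2)%N eqn_pmul2r // => /eqP.
Qed.

Lemma num_order_iota d : num_order d L = num_order d SL2F5.
Proof.
rewrite !num_orderE /L /= morphimEdom big_imset /=; last exact/injmP/(typeVI_inj hG).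
by apply: eq_bigr => x SLx; rewrite order_injm ?(typeVI_inj hG).
Qed.

Lemma sub_LS_H : L :* S \subset H :\: L.
Proof.
have LH := normal_sub (typeVI_normal hG).
have HS : S \in H by rewrite (typeVI_H hG) mem_gen // setU11.
apply/subsetP => _ /rcosetP[y Ly ->].
by rewrite inE groupMl // (typeVI_S hG) groupM // (subsetP LH).
Qed.

(** The coset lies in the complement of [L], and both have 120 elements. *)
Lemma H_setD_L : H :\: L = L :* S.
Proof.
apply/esym/eqP; rewrite eqEcard sub_LS_H cardsD card_rcoset.
rewrite (setIidPr (normal_sub (typeVI_normal hG))) (typeVI_card hG).
by rewrite typeVI_cardL.
Qed.

(** Write [(x S)^2] as [x (S x S^-1) S^2]. *)
Lemma iota_S_square x : x \in SL2F5 ->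
  (iota x * S) ^+ 2 = iota (x * theta x * negI).
Proof.
move=> SLx; have SLtx := theta_SL2F5 SLx.
rewrite (morphM iota (groupM SLx SLtx) negI_SL2F5) (morphM iota SLx SLtx).
rewrite -(typeVI_theta hG SLx).
by rewrite -(typeVI_S2 hG) expgS expg1 !mulgA mulgKV.
Qed.

Lemma order_LS y : y \in L :* S -> y ^+ 2 \in L /\ #[y] = (2 * #[y ^+ 2])%N.
Proof.
move=> LSy; have := subsetP sub_LS_H _ LSy; rewrite inE => /andP[notLy Hy].
suff Ly2 : y ^+ 2 \in L by split=> //; apply: order_sq_index2 Ly2.
case/rcosetP: LSy => _ /morphimP[x _ SLx ->] ->.
have SLx2 : x * theta x * negI \in SL2F5.
  exact: groupM (groupM SLx (theta_SL2F5 SLx)) negI_SL2F5.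
by rewrite iota_S_square // mem_morphim.
Qed.

Lemma num_order_LS d : num_order d (L :* S) = num_order_SL2F5S d.
Proof.
rewrite num_orderE sum_rcoset /L /= morphimEdom big_imset /=; last first.
  exact/injmP/(typeVI_inj hG).
rewrite -sum_SL2F5_square; apply: eq_bigr => x SLx.
have [|_ ->] := @order_LS (iota x * S).
  by rewrite mem_rcoset mulgK mem_morphim.
have SLx2 : x * theta x * negI \in SL2F5.
  exact: groupM (groupM SLx (theta_SL2F5 SLx)) negI_SL2F5.
rewrite iota_S_square // order_injm ?(typeVI_inj hG) //.
by rewrite quad_of_order // quad_of_square.
Qed.

(** * Orders of the products k h and the count in G *)

Lemma coprime_K120 : coprime #|K| 120.
(* 120 divides [30 ^ 3]. *)
Proof. exact: coprime_dvdr (coprimeXr 3 (typeVI_coprime hG)). Qed.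

Lemma dvdn_orderL y : y \in L -> #[y] %| 120.
Proof. by move=> Ly; rewrite -typeVI_cardL order_dvdG. Qed.

(** Lagrange in H gives only a divisor of 240. Instead, [y] itself makes the count for its order
    positive, so this order is 4, 8 or 12. *)
Lemma dvdn_orderLS y : y \in L :* S -> #[y] %| 120.
Proof.
move=> LSy; have: (0 < num_order_SL2F5S #[y])%N.
  rewrite -num_order_LS /num_order card_gt0; apply/set0Pn; exists y.
  by rewrite inE LSy /=.
by move: #[y]; do 13!case=> //.
Qed.

Lemma order_KL k y : k \in K -> y \in L -> #[k * y] = (#[k] * #[y])%N.
Proof.
move=> Kk Ly; apply: orderM.
  exact/esym/(centP (subsetP (typeVI_triv hG) y Ly)).
apply: coprime_dvdl (order_dvdG Kk) _.
exact: coprime_dvdr (dvdn_orderL Ly) coprime_K120.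
Qed.

Lemma order_KLS k y : k \in K -> y \in L :* S ->
  #[k * y] = (#[k * sigma k] * #[y])%N.
Proof.
move=> Kk LSy; have [Ly2 ->] := order_LS LSy.
have [_ _ _ tiKH] := sdprodP (typeVI_sdprod hG).
have cKL := typeVI_triv hG.
have Kks : k * sigma k \in K.
  by rewrite groupM ?(Aut_closed (typeVI_Aut hG)).
have [notLy Hy] : y \notin L /\ y \in H.
  by have := subsetP sub_LS_H _ LSy; rewrite inE => /andP[].
(* With [y = l S] and [l] centralizing K, conjugation by [y] acts on K as [sigma]. *)
have ky2 : (k * y) ^+ 2 = k * sigma k * y ^+ 2.
  case/rcosetP: LSy => l Ll ->; rewrite -(typeVI_act hG Kk).
  set c := S * k * S^-1; have Sk : S * k = c * S by rewrite mulgKV.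
  have lc : l * c = c * l.
    apply: (centP (subsetP cKL l Ll)).
    by rewrite /c (typeVI_act hG Kk) (Aut_closed (typeVI_Aut hG)).
  clearbody c; rewrite !expgS expg0 !mulg1 !mulgA -[k * l * S * k]mulgA Sk.
  by rewrite !mulgA -[k * l * c]mulgA lc !mulgA.
(* The doubling of the order is applied with the subgroup K L: if [k * y] were in it, [K :&: H = 1]
   would force [y] into [L]. *)
have notKL : k * y \notin K <*> L.
  apply: contra notLy; rewrite norm_joinEr ?cents_norm //.
  case/mulsgP=> k' l Kk' Ll eq_ky; have Hl : l \in H.
    exact: subsetP (normal_sub (typeVI_normal hG)) _ Ll.
  have: y * l^-1 \in K :&: H.
    rewrite inE [_ \in H]groupM ?groupV // andbT.
    by rewrite -[y](mulKg k) eq_ky mulgA mulgK groupM ?groupV.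
  by rewrite tiKH => /set1P/(canRL (mulgKV _)); rewrite mul1g => ->.
rewrite (order_sq_index2 notKL) ky2.
  by rewrite order_KL // mulnCA.
by rewrite groupM // mem_gen // inE ?Kks ?Ly2 ?orbT.
Qed.

Lemma num_orderG d : num_order d G =
  (\sum_(h in L) \sum_(k in K) (#[k] * #[h] == d) +
   \sum_(h in L :* S) \sum_(k in K) (#[k * sigma k]%g * #[h] == d))%N.
Proof.
have [_ <- _ tiKH] := sdprodP (typeVI_sdprod hG).
rewrite num_orderE sum_TI_mulg // (big_setID L) H_setD_L /=.
rewrite (setIidPr (normal_sub (typeVI_normal hG))).
congr (_ + _)%N; apply: eq_bigr => h Lh; apply: eq_bigr => k Kk.
  by rewrite order_KL.
by rewrite order_KLS.
Qed.

Lemma dvdn_order_bnum k : k \in K -> #[k * sigma k] %| #|K|.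
Proof.
by move=> Kk; rewrite order_dvdG ?groupM ?(Aut_closed (typeVI_Aut hG)).
Qed.

(** In both sums the order is a divisor of [#|K|] times a divisor of 120. These numbers are coprime,
    so the indicator factors and each double sum becomes a product of two counts. *)
Lemma num_orderG_mul d1 d2 : (d1 %| #|K| -> d2 %| 120 ->
  num_order (d1 * d2) G =
    num_order d1 K * num_order d2 SL2F5
    + bnum K sigma d1 * num_order d2 (L :* S))%N.
Proof.
move=> dv_d1 dv_d2; rewrite num_orderG -num_order_iota !num_orderE.
have -> : bnum K sigma d1 = (\sum_(k in K) (#[k * sigma k]%g == d1))%N.
  exact: card_sum_order.
rewrite !big_distrlr /= [X in _ = (X + _)%N]exchange_big.
rewrite [X in _ = (_ + X)%N]exchange_big /=.
congr (_ + _)%N; apply: eq_bigr => h Lh; apply: eq_bigr => k Kk.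
  rewrite mulnb (eqn_mul_coprime coprime_K120) ?order_dvdG //.
  exact: dvdn_orderL.
rewrite mulnb (eqn_mul_coprime coprime_K120) ?dvdn_order_bnum //.
exact: dvdn_orderLS.
Qed.

Lemma num_orderG_eq0 d :
  ~ (exists d1 d2 : nat, [/\ d1 %| #|K|, d2 %| 120 & d = d1 * d2]%N) ->
  num_order d G = 0%N.
Proof.
move=> no_d; rewrite num_orderG !big1 // => h Lh; rewrite big1 // => k Kk.
  case: eqP => // def_d; case: no_d; exists #[k * sigma k], #[h].
  by rewrite dvdn_order_bnum // dvdn_orderLS.
case: eqP => // def_d; case: no_d; exists #[k], #[h].
by rewrite order_dvdG // dvdn_orderL.
Qed.

Lemma sigma_morph : {in K &, {morph sigma : x y / x * y}}.
Proof. by have /morphicP := Aut_morphic (typeVI_Aut hG). Qed.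

End TypeVI.

Theorem theorem5p5 (gT : finGroupType) (G K H : {group gT}) (A B S : gT)
    (iota : {morphism SL2F5 >-> gT}) (sigma : {perm gT}) (m n r s t : nat)
    (hG : typeVI G K H A B S iota sigma m n r s t) :
  let L := (iota @* SL2F5)%g in
  ((forall d1 d2 : nat, d1 %| #|K| -> d2 %| 120 ->
      num_order (d1 * d2) G =
        num_order d1 K * num_order d2 SL2F5
        + bnum K sigma d1 * num_order d2 (L :* S)%g) /\
   (forall d1 d2 d1' d2' : nat,
      d1 %| #|K| -> d2 %| 120 -> d1' %| #|K| -> d2' %| 120 ->
      d1 * d2 = d1' * d2' -> d1 = d1' /\ d2 = d2') /\
   (forall d : nat, d %| 240 * #|K| ->
      ~ (exists d1 d2 : nat, [/\ d1 %| #|K|, d2 %| 120 & d = d1 * d2]) ->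
      num_order d G = 0)) /\
  ((forall d1 : nat, d1 %| #|K| ->
      exists e f : nat, [/\ e %| m, f %| n & d1 = e * f]) /\
   (forall e f : nat, e %| m -> f %| n ->
      num_order (e * f) K =
        totient e *
        \sum_(j < n | #[(B ^+ j)%g]%g == f)
           gcdn m (geomB r j f) * (e %| m %/ gcdn m (geomB r j f)))) /\
  (forall d1 : nat, d1 %| #|K| ->
     bnum K sigma d1 =
       \sum_(j < n)
          tau_ m n r s t j * totient (d1 %/ e_ n t j) *
          ((e_ n t j %| d1) && (d1 %/ e_ n t j %| m %/ tau_ m n r s t j))) /\
  (forall d : nat, num_order d SL2F5 = num_order_SL2F5 d) /\
  (forall d : nat, num_order d (L :* S)%g = num_order_SL2F5S d).
Proof.
move=> L; have hK := typeVI_K hG.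
split; last split; last split; last split.
- split; [exact: num_orderG_mul hG | split=> [d1 d2 d1' d2'|d _]].
    move=> dv1 dv2 dv1' dv2' /eqP.
    rewrite (eqn_mul_coprime (coprime_K120 hG)) //.
    by case/andP=> /eqP-> /eqP->.
  exact: num_orderG_eq0 hG d.
- split; last exact: num_order_typeI hK.
  (* The second factor divides [n] because [d1] divides [gcdn d1 m * n = gcdn (d1 * n) (m * n)]. *)
  rewrite (typeI_card hK) => d1 dv_d1; exists (gcdn d1 m), (d1 %/ gcdn d1 m).
  have g_gt0 : 0 < gcdn d1 m by rewrite gcdn_gt0 (typeI_m hK) orbT.
  split; first exact: dvdn_gcdr; last by rewrite mulnC divnK ?dvdn_gcdl.
  rewrite -(dvdn_pmul2l g_gt0) mulnC divnK ?dvdn_gcdl // muln_gcdl dvdn_gcd.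
  by rewrite dvdn_mulr.
- by move=> d _; exact: bnum_typeI (sigma_morph hG) (typeVI_sA hG) (typeVI_sB hG).
- exact: num_order_SL2F5E.
exact: num_order_LS hG.
Qed.
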